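(* Let $p$ be a prime number, let $r\ge 2$, and for each $i\in\{1,\dots,r\}$ let $n_i,m_i$ be non-zero integers with $0<n_i\le |m_i|$ and $(n_i,|m_i|)\ne(1,1)$. Let $$G=\langle a,t_1,\dots,t_r\mid t_ia^{n_i}t_i^{-1}=a^{m_i},\ i\in\{1,\dots,r\}\rangle,$$ and let $p^{\sigma_i}$ be the highest power of $p$ dividing $m_i$. Then $G$ is a residually finite $p$-group if and only if either $n_i=m_i=p^{\sigma_i}$ for all $i\in\{1,\dots,r\}$, or $p=2$ and $n_i=|m_i|=2^{\sigma_i}$ for all $i\in\{1,\dots,r\}$.
   Context: A group $G$ is a residually finite $p$-group if for every non-trivial $g\in G$ there is a homomorphism from $G$ to a finite $p$-group under which the image of $g$ is non-trivial; equivalently, the intersection of all normal subgroups of $G$ of finite $p$-power index is trivial. *)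

(* Defs.v *)
From HB Require Import structures.
From mathcomp Require Import all_boot all_order all_algebra all_fingroup.
From mathcomp Require Import all_solvable.
(* generic_quotient comes last so that repr is not fingroup's. *)
From mathcomp Require Import boolp generic_quotient.

Set Implicit Arguments.
Unset Strict Implicit.
Unset Printing Implicit Defensive.

Import GRing.Theory Num.Theory.

Local Open Scope group_scope.
Local Open Scope quotient_scope.

Definition residually_finite_p_group (p : nat) (G : groupType) : Prop :=
  forall g : G, g <> 1 ->
    exists (H : finGroupType) (f : {multiplicative G -> H}),
      p.-group [set: H] /\ f g <> 1.

(* A letter (x, false) stands for the generator x, and (x, true) for its
   formal inverse. *)
Definition word (X : Type) : Type := seq (X * bool).

Definition winv (X : Type) (w : word X) : word X :=
  rev [seq (l.1, ~~ l.2) | l <- w].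

Definition wpow (X : Type) (x : X) (k : int) : word X :=
  nseq `|k|%N (x, (k < 0)%R).

Section Presentation.

(* [rel u v] means that u = v is one of the defining relations. *)
Variables (X : choiceType) (rel : word X -> word X -> Prop).

Inductive pres_eq : word X -> word X -> Prop :=
| pres_eq_rel u v : rel u v -> pres_eq u v
| pres_eq_cancel x b : pres_eq [:: (x, b); (x, ~~ b)] [::]
| pres_eq_cat u u' v v' :
    pres_eq u u' -> pres_eq v v' -> pres_eq (u ++ v) (u' ++ v')
| pres_eq_refl u : pres_eq u u
| pres_eq_sym u v : pres_eq u v -> pres_eq v u
| pres_eq_trans u v w : pres_eq u v -> pres_eq v w -> pres_eq u w.

Definition pres_eqb (u v : word X) : bool := `[< pres_eq u v >].

Fact pres_eqb_refl : reflexive pres_eqb.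
Proof. by move=> u; apply/asboolP; apply: pres_eq_refl. Qed.

Fact pres_eqb_sym : symmetric pres_eqb.
Proof. by move=> u v; apply/asboolP/asboolP; apply: pres_eq_sym. Qed.

Fact pres_eqb_trans : transitive pres_eqb.
Proof.
move=> v u w /asboolP uv /asboolP vw.
by apply/asboolP; apply: pres_eq_trans uv vw.
Qed.

Canonical pres_equiv := EquivRel pres_eqb pres_eqb_refl pres_eqb_sym
  pres_eqb_trans.

(* The group < X | u = v for all u, v with rel u v >. *)
Definition presented : Type := {eq_quot pres_equiv}.

HB.instance Definition _ := Choice.on presented.
HB.instance Definition _ := EqQuotient.on presented.

(* The element of the presented group represented by a word. *)
Definition pres_class (w : word X) : presented := \pi_presented w.

Lemma pres_classP (u v : word X) :
  pres_class u = pres_class v <-> pres_eq u v.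
Proof. by split=> [/eqmodP/asboolP | uv] //; apply/eqmodP/asboolP. Qed.

Lemma pres_class_repr (g : presented) : pres_class (repr g) = g.
Proof. exact: reprK. Qed.

Lemma pres_class_ind (P : presented -> Prop) :
  (forall w, P (pres_class w)) -> forall g, P g.
Proof. by move=> Pw g; rewrite -[g]pres_class_repr. Qed.

Lemma pres_eq_mulV (w : word X) : pres_eq (w ++ winv w) [::].
Proof.
elim: w => [|[x b] w IHw]; first exact: pres_eq_refl.
rewrite /winv /= rev_cons -cats1 -cat_cons catA -cat1s -!catA.
apply: pres_eq_trans (pres_eq_cancel x b).
rewrite (catA w); apply: (@pres_eq_cat [:: _] [:: _]); first exact: pres_eq_refl.
by apply: (@pres_eq_cat _ [::] _ _ IHw); apply: pres_eq_refl.
Qed.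

Lemma winvK : involutive (@winv X).
Proof.
move=> w; rewrite /winv map_rev revK -map_comp -[RHS]map_id.
by apply: eq_map => -[x b] /=; rewrite negbK.
Qed.

Lemma pres_eq_winv (u v : word X) :
  pres_eq u v -> pres_eq (winv u) (winv v).
Proof.
move=> uv.
have vVu : pres_eq (winv u ++ v) [::].
  apply: pres_eq_trans (pres_eq_mulV (winv u)); rewrite winvK.
  by apply: pres_eq_cat (pres_eq_refl _) _; apply: pres_eq_sym.
have := pres_eq_cat vVu (pres_eq_refl (winv v)).
rewrite -catA; apply: pres_eq_trans; rewrite -[X in pres_eq X]cats0.
apply: pres_eq_cat (pres_eq_refl _) _.
exact: pres_eq_sym (pres_eq_mulV v).
Qed.

Definition pres_one : presented := pres_class [::].
Definition pres_mul (g h : presented) : presented :=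
  pres_class (repr g ++ repr h).
Definition pres_inv (g : presented) : presented := pres_class (winv (repr g)).

Lemma pres_mulE (u v : word X) :
  pres_mul (pres_class u) (pres_class v) = pres_class (u ++ v).
Proof.
by apply/pres_classP; apply: pres_eq_cat; apply/pres_classP;
  rewrite pres_class_repr.
Qed.

Lemma pres_invE (u : word X) : pres_inv (pres_class u) = pres_class (winv u).
Proof.
by apply/pres_classP; apply: pres_eq_winv; apply/pres_classP;
  rewrite pres_class_repr.
Qed.

Fact pres_mulA : associative pres_mul.
Proof.
elim/pres_class_ind=> u; elim/pres_class_ind=> v; elim/pres_class_ind=> w.
by rewrite !pres_mulE catA.
Qed.

Fact pres_mul1 : left_id pres_one pres_mul.
Proof. by elim/pres_class_ind=> u; rewrite pres_mulE. Qed.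

Fact pres_mulr1 : right_id pres_one pres_mul.
Proof. by elim/pres_class_ind=> u; rewrite pres_mulE cats0. Qed.

Fact pres_mulgV : right_inverse pres_one pres_inv pres_mul.
Proof.
elim/pres_class_ind=> u; rewrite pres_invE pres_mulE.
by apply/pres_classP; apply: pres_eq_mulV.
Qed.

Fact pres_mulVg : left_inverse pres_one pres_inv pres_mul.
Proof.
elim/pres_class_ind=> u; rewrite pres_invE pres_mulE.
by apply/pres_classP; rewrite -[X in _ ++ X]winvK; apply: pres_eq_mulV.
Qed.

HB.instance Definition _ := isGroup.Build presented
  pres_mulA pres_mul1 pres_mulr1 pres_mulVg pres_mulgV.

End Presentation.

(* The generators are a = None and t_i = Some i. *)
Definition gbs_rel (r : nat) (n m : 'I_r -> int)
    (u v : word (option 'I_r)) : Prop :=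
  exists i : 'I_r,
    u = [:: (Some i, false)] ++ wpow None (n i) ++ [:: (Some i, true)] /\
    v = wpow None (m i).

(* < a, t_1, ..., t_r | t_i a^(n_i) t_i^-1 = a^(m_i) > *)
Definition gbs (r : nat) (n m : 'I_r -> int) : groupType :=
  presented (gbs_rel n m).

(* Main.v *)
Require Import Defs.
From HB Require Import structures.
From mathcomp Require Import all_boot all_order all_algebra all_fingroup.
From mathcomp Require Import all_solvable.
From mathcomp Require Import ring zify.
(* generic_quotient comes last so that repr is not fingroup's. *)
From mathcomp Require Import generic_quotient.

Set Implicit Arguments.
Unset Strict Implicit.
Unset Printing Implicit Defensive.

Import GRing.Theory Num.Theory.

Local Open Scope ring_scope.

(* Write q_i for the p-part of m_i.

   Necessity. In a finite p-quotient the orders of a^(n_i) and a^(m_i) agree,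
   which forces n_i and m_i to have the same p-part since a has infinite order
   in G; moreover t_i normalises <a^(q_i)>, so conjugates of a^(q_i) by t_i and
   its inverse commute with a. If G is residually p these commutations hold in
   G, where they fail unless n_i = |m_i| = q_i: this is Britton's lemma, here
   replaced by an action of G on Z x N in which a translates Z freely and t_i is
   induced by a bijection from the orbits of a^(n_i) to those of a^(m_i) that
   can be prescribed on finitely many orbits. The case n_i = 1 < |m_i| needs a
   second generator t_j: t_i then normalises <a> and the conjugate of a^(q_j)
   by t_j t_i^-1 commutes with a. Finally, for odd p no element of a finite
   p-group inverts a non-trivial element.

   Sufficiency. Put t_(i,z) = a^z t_i a^-z. Every element of G is a^k times a
   product of powers t_(i,z)^e in which consecutive pairs (i, z), with z taken
   modulo q_i, are distinct. Let P be the p-group of affine maps of Z/p^N with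
   slope 1 modulo p, in which a is the unit translation and t_i is the
   multiplication by m_i / n_i = +1 or -1. For a p-group U, map G to the
   wreath product of P and U by decorating t_i with a function of
   x^-1 0 modulo q_i, for x in P; a product of powers as above is sent
   to a reduced word of a free group evaluated in U, so it suffices that free
   groups are residually p, for which U is a congruence subgroup of matrices
   over Z/p^k. *)

(** * Integer powers in an arbitrary group *)

Section IntegerPowers.
Local Open Scope group_scope.
Variable G : groupType.
Implicit Types (x y : G) (k l : int).

Definition expgz x k : G :=
  match k with Posz n => x ^+ n | Negz n => x ^- n.+1 end.

Lemma expgz0 x : expgz x 0 = 1. Proof. by []. Qed.

Lemma expgz1 x : expgz x 1%R = x. Proof. exact: expg1. Qed.

Lemma expgzN1 x : expgz x (-1)%R = x^-1. Proof. by rewrite /= expg1. Qed.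

Lemma expgzS x k : expgz x (k + 1)%R = expgz x k * x.
Proof.
case: k => [n|[|n]].
- by rewrite /= addn1 expgSr.
- by rewrite /= expg1 mulVg.
- have -> : (Negz n.+1 + 1 = Negz n)%R by lia.
  by rewrite /= [in RHS]expgS invgM mulgVK.
Qed.

Lemma expgzB1 x k : expgz x (k - 1)%R = expgz x k * x^-1.
Proof. by rewrite -[in RHS](subrK 1%R k) expgzS mulgK. Qed.

Lemma expgzD x k l : expgz x (k + l)%R = expgz x k * expgz x l.
Proof.
elim: l => [|n IH|n IH]; first by rewrite addr0 expgz0 mulg1.
  by rewrite -addn1 PoszD addrA !expgzS IH mulgA.
by rewrite -addn1 PoszD opprD addrA !expgzB1 IH mulgA.
Qed.

Lemma expgzN x k : expgz x (- k)%R = (expgz x k)^-1.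
Proof.
by apply: (mulgI (expgz x k)); rewrite -expgzD subrr expgz0 mulgV.
Qed.

Lemma expgzM x k l : expgz x (k * l)%R = expgz (expgz x k) l.
Proof.
elim: l => [|n IH|n IH]; first by rewrite mulr0.
  by rewrite -addn1 PoszD mulrDr mulr1 !expgzD IH expgz1.
by rewrite -addn1 PoszD opprD mulrDr mulrN1 !expgzD IH expgzN1 (expgzN x k).
Qed.

Lemma expgzJ x y k : expgz (x ^ y) k = expgz x k ^ y.
Proof. by case: k => n /=; rewrite ?conjVg conjXg. Qed.

End IntegerPowers.

(** * Homomorphisms from, and actions of, a presented group *)

Section Presentations.
Local Open Scope group_scope.
Variables (X : choiceType) (rel : word X -> word X -> Prop).

Definition eval_word (H : groupType) (h : X -> H) (w : word X) : H :=
  foldr (fun l y => (if l.2 then (h l.1)^-1 else h l.1) * y) 1 w.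

Definition pres_gen (x : X) : presented rel := pres_class rel [:: (x, false)].

Section Eval.
Variables (H : groupType) (h : X -> H).

Lemma eval_word_cat u v :
  eval_word h (u ++ v) = eval_word h u * eval_word h v.
Proof. by elim: u => [|l u IH] /=; rewrite ?mul1g // IH mulgA. Qed.

Lemma eval_wpow x k : eval_word h (wpow x k) = expgz (h x) k.
Proof.
have nseqE b j :
    eval_word h (nseq j (x, b)) = (if b then (h x)^-1 else h x) ^+ j.
  by elim: j => //= j ->; rewrite expgS.
by case: k => n; rewrite /wpow nseqE // expVgn.
Qed.

(** Von Dyck's theorem: by induction on [pres_eq], evaluation is constant on classes, so it can be
    computed on representatives. *)
Lemma pres_lift :
    (forall u v, rel u v -> eval_word h u = eval_word h v) ->
  exists f : {multiplicative presented rel -> H},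
    (f 1 = 1) /\ forall x, f (pres_gen x) = h x.
Proof.
move=> hrel.
have hP u v : pres_eq rel u v -> eval_word h u = eval_word h v.
  elim=> {u v} [u v|x b|u u' v v' _ e1 _ e2|u|u v _ e|u v w _ e1 _ e2].
  - exact: hrel.
  - by case: b; rewrite /= mulg1 ?mulgV ?mulVg.
  - by rewrite !eval_word_cat e1 e2.
  - by [].
  - by rewrite e.
  - by rewrite e1 e2.
pose f (g : presented rel) := eval_word h (repr g).
have fE w : f (pres_class rel w) = eval_word h w.
  by apply/hP/pres_classP; rewrite pres_class_repr.
have fM : {morph f : x y / x * y}.
  move=> g g'; rewrite -[g]pres_class_repr -[g']pres_class_repr.
  by rewrite [_ * _]pres_mulE !fE eval_word_cat.
pose fm := isMultiplicative.Build (presented rel) H f fM.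
pose F : {multiplicative presented rel -> H} := HB.pack f fm.
by exists F; split=> [|x]; [exact: (fE [::]) | rewrite [F _]fE /= mulg1].
Qed.

End Eval.

Lemma pres_classE w : pres_class rel w = eval_word pres_gen w.
Proof.
have cat u v : pres_class rel (u ++ v) = pres_class rel u * pres_class rel v.
  by rewrite [RHS]pres_mulE.
elim: w => [|[x b] w IH] //=; rewrite -cat1s cat IH; congr (_ * _).
by case: b => //; rewrite [RHS]pres_invE.
Qed.

Lemma presE u v : rel u v -> eval_word pres_gen u = eval_word pres_gen v.
Proof. by rewrite -!pres_classE => uv; apply/pres_classP/pres_eq_rel. Qed.

Lemma pres_gen_ind (P : presented rel -> Prop) :
    P 1 ->
    (forall x g, P g -> P (pres_gen x * g) /\ P ((pres_gen x)^-1 * g)) ->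
  forall g, P g.
Proof.
move=> P1 PM; elim/pres_class_ind=> w; rewrite pres_classE.
by elim: w => //= -[x b] w /(PM x)[Px Pvx]; case: b.
Qed.

(** The analogue of [pres_lift] for permutations of a possibly infinite [S], given letter by
    letter. *)
Lemma pres_act (S : Type) (act : X -> bool -> S -> S) :
    (forall x b, cancel (act x b) (act x (~~ b))) ->
    (forall u v s, rel u v -> foldr (fun l => act l.1 l.2) s u =
                              foldr (fun l => act l.1 l.2) s v) ->
  exists F : presented rel -> S -> S,
    [/\ forall g g' s, F (g * g') s = F g (F g' s),
        forall x s, F (pres_gen x) s = act x false s
      & forall x s, F (pres_gen x)^-1 s = act x true s].
Proof.
move=> actK arel; pose F (u : word X) s := foldr (fun l => act l.1 l.2) s u.
have FC u v s : F (u ++ v) s = F u (F v s) by rewrite /F foldr_cat.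
have FP u v : pres_eq rel u v -> F u =1 F v.
  elim=> {u v} [u v uv|x b|u u' v v' _ e1 _ e2|u|u v _ e|u v w _ e1 _ e2] s.
  - exact: arel.
  - by have:= actK x (~~ b) s; rewrite negbK.
  - by rewrite !FC e2 e1.
  - by [].
  - by rewrite e.
  - by rewrite e1 e2.
have FE w : F (repr (pres_class rel w)) =1 F w.
  by apply/FP/pres_classP; rewrite pres_class_repr.
exists (fun g => F (repr g)); split=> [g g' s|x s|x s]; last first.
- by rewrite [(pres_gen x)^-1]pres_invE FE.
- exact: FE.
rewrite -[g]pres_class_repr -[g']pres_class_repr.
by rewrite [_ * _]pres_mulE !FE FC.
Qed.

End Presentations.

(** * Bijections with prescribed values, and the maps between translation orbits that they induce *)

Lemma extend_partial_injection (T : eqType) (L : seq (T * T)) :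
    uniq (unzip1 L) -> uniq (unzip2 L) ->
  exists f g : T -> T,
    [/\ cancel f g, cancel g f & {in L, forall xy, f xy.1 = xy.2}].
Proof.
elim: L => [|[x y] L IH] /=; first by exists id, id; split.
case/andP=> xL uL1 /andP[yL uL2]; have [f [g [fK gK fL]]] := IH uL1 uL2.
(* The transposition of [f x] and [y]; composing [f] with it corrects the value at [x] and keeps the
   pairs of [L], which avoid both points. *)
pose s z := if z == f x then y else if z == y then f x else z.
have sK : involutive s.
  move=> z; rewrite /s; case: (eqVneq z (f x)) => [->|zf].
    by case: (eqVneq y (f x)) => // _; rewrite eqxx.
  case: (eqVneq z y) => [->|zy]; first by rewrite eqxx.
  by rewrite (negPf zf) (negPf zy).
exists (s \o f), (g \o s); split=> [z|z|[x' y']] /=; rewrite ?sK ?gK ?fK //.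
rewrite inE => /predU1P[[-> ->]|x'L]; first by rewrite /s eqxx.
have /= fx' := fL _ x'L; rewrite fx' /s; case: eqP => [fx|_].
  case/negP: xL; have <-: x' = x by rewrite -[x]fK -fx -fx' fK.
  exact: (map_f fst x'L).
by case: eqP => // y'y; case/negP: yL; rewrite -y'y; apply: (map_f snd x'L).
Qed.

(* The points of [int * nat] carry the free translation by 1 on the first
   factor. Translation by [e] has the orbits [(rho, c)] with
   [0 <= rho < `|e|], encoded by the numbers [`|e| * c + rho]; the map
   [orbit_map e e' f] sends orbits of the translation by [e] to orbits of the
   translation by [e'] as [f] does on the codes. *)
Definition orbit_map (e e' : int) (f : nat -> nat) (s : int * nat) :
    int * nat :=
  let k := f (`|e| * s.2 + `|(s.1 %% e)%Z|)%N in
  ((s.1 %/ e)%Z * e' + (k %% `|e'|)%N%:Z, (k %/ `|e'|)%N).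

Arguments orbit_map : simpl never.

Lemma orbit_mapE (e e' : int) f z c c' (j : nat) :
    (j < `|e'|)%N -> f (`|e| * c + `|(z %% e)%Z|)%N = (c' * `|e'| + j)%N ->
  orbit_map e e' f (z, c) = ((z %/ e)%Z * e' + j%:Z, c').
Proof.
move=> je' fE; rewrite /orbit_map /= fE modnMDl modn_small //.
by rewrite divnMDl ?divn_small ?addn0 //; lia.
Qed.

(** The position [z %/ e] along an orbit is carried over unchanged, so only the map on codes has to
    be inverted. *)
Lemma orbit_mapK (e e' : int) f g :
    e != 0 -> e' != 0 -> cancel f g ->
  cancel (orbit_map e e' f) (orbit_map e' e g).
Proof.
move=> e0 e'0 fK [z c]; set k := f (`|e| * c + `|(z %% e)%Z|)%N.
have k1 : (k %% `|e'| < `|e'|)%N by rewrite ltn_pmod ?absz_gt0.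
have k2 : 0 <= (k %% `|e'|)%N%:Z < `|e'|%N%:Z by rewrite ltz_nat k1.
rewrite (@orbit_mapE e e' f z c (k %/ `|e'|) _ k1) -?divn_eq //.
have r1 : (`|(z %% e)%Z| < `|e|)%N.
  by rewrite -ltz_nat gez0_abs ?modz_ge0 // ltz_mod.
rewrite (@orbit_mapE _ _ _ _ _ c _ r1).
  by rewrite divzMDl // (divz_small k2) addr0 gez0_abs ?modz_ge0 // -divz_eq.
by rewrite modzMDl -modz_abs (modz_small k2) /= mulnC -divn_eq fK mulnC.
Qed.

(** For [e = n i] and [e' = m i] this is the defining relation of [t_i], whatever [f] is. *)
Lemma orbit_map_shift (e e' : int) f z c l : e != 0 ->
  orbit_map e e' f (z + l * e, c) =
  ((orbit_map e e' f (z, c)).1 + l * e', (orbit_map e e' f (z, c)).2).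
Proof.
move=> e0; rewrite /orbit_map /= [z + _]addrC modzMDl divzMDl //.
by congr (_, _); ring.
Qed.

(** * Non-commuting conjugates of powers of a, detected by actions on Z x N *)

Section Britton.
Local Open Scope group_scope.
Variables (r : nat) (n m : 'I_r -> int).
Hypotheses (n0 : forall i, n i <> 0%R) (m0 : forall i, m i <> 0%R).

Definition gbs_a : gbs n m := pres_gen (gbs_rel n m) None.
Definition gbs_t (i : 'I_r) : gbs n m := pres_gen (gbs_rel n m) (Some i).

Definition gbs_stable (i : 'I_r) (b : bool) : gbs n m :=
  if b then (gbs_t i)^-1 else gbs_t i.

(** Conjugation by [gbs_stable i b] takes the power [gbs_exp i b] of a to the power
    [gbs_exp i (~~ b)], so [t_i] and its inverse are treated alike. *)
Definition gbs_exp (i : 'I_r) (b : bool) : int := if b then m i else n i.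

Lemma gbs_exp_neq0 i b : gbs_exp i b != 0%R.
Proof. by case: b; apply/eqP; [exact: m0|exact: n0]. Qed.

Lemma gbs_relation i :
  gbs_t i * expgz gbs_a (n i) * (gbs_t i)^-1 = expgz gbs_a (m i).
Proof.
have /presE : gbs_rel n m ([:: (Some i, false)] ++ wpow None (n i)
    ++ [:: (Some i, true)]) (wpow None (m i)) by exists i.
by rewrite !eval_word_cat !eval_wpow /= !mulg1 mulgA.
Qed.

Lemma gbs_act (f : 'I_r -> bool -> nat -> nat) :
    (forall i b, cancel (f i b) (f i (~~ b))) ->
  exists F : gbs n m -> int * nat -> int * nat,
    [/\ forall g g' s, F (g * g') s = F g (F g' s),
        forall k z c, F (expgz gbs_a k) (z, c) = ((z + k)%R, c)
      & forall i b s, F (gbs_stable i b) s =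
          orbit_map (gbs_exp i b) (gbs_exp i (~~ b)) (f i b) s].
Proof.
move=> fK; pose sh (b : bool) : int := if b then (-1)%R else 1%R.
pose act (x : option 'I_r) b (s : int * nat) :=
  if x is Some i then orbit_map (gbs_exp i b) (gbs_exp i (~~ b)) (f i b) s
  else ((s.1 + sh b)%R, s.2).
have actK x b : cancel (act x b) (act x (~~ b)).
  case: x => [i|[z c]] /=.
    by have := fK i b; case: b; apply: orbit_mapK; apply/eqP;
      [exact: m0|exact: n0|exact: n0|exact: m0].
  by congr (_, _); case: b; rewrite /sh /=; lia.
have powE k z c : foldr (fun l => act l.1 l.2) (z, c) (wpow None k)
    = ((z + k)%R, c).
  have powE' b j : foldr (fun l => act l.1 l.2) (z, c) (nseq j (None, b))
      = ((z + sh b *+ j)%R, c).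
    by elim: j => [|j IH] /=; rewrite ?mulr0n ?addr0 // IH mulrSr addrA.
  by rewrite /wpow powE'; congr (_, _); case: k => j; rewrite /sh /=; lia.
have [|F [FM Fx FVx]] := pres_act actK (rel := gbs_rel n m).
  move=> _ _ [z c] [i [-> ->]]; rewrite powE !foldr_cat.
  (* Any point is the image under [t_i] of its preimage, to which [orbit_map_shift] applies. *)
  have := actK (Some i) true (z, c).
  case Es: (act (Some i) true (z, c)) => [z' c'].
  rewrite [foldr _ _ [:: (_, true)]]Es powE -[X in (_ + X)%R]mul1r => sK.
  rewrite [LHS]orbit_map_shift ?(gbs_exp_neq0 i false) //.
  by rewrite [orbit_map _ _ _ _]sK mul1r.
have F1 s : F 1 s = s.
  have: F (gbs_a * gbs_a^-1) s = s by rewrite FM Fx FVx (actK _ true).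
  by rewrite mulgV.
exists F; split=> // [k z c|i [] s]; rewrite /gbs_stable ?Fx ?FVx //.
have Fa z' c' : F gbs_a (z', c') = ((z' + 1)%R, c') by rewrite Fx.
have FVa z' c' : F gbs_a^-1 (z', c') = ((z' - 1)%R, c') by rewrite FVx.
elim: k z => [|j IH|j IH] z; first by rewrite F1 addr0.
  by rewrite -addn1 PoszD expgzS FM Fa IH; congr (_, _); ring.
by rewrite -addn1 PoszD opprD expgzB1 FM FVa IH; congr (_, _); ring.
Qed.

Lemma gbs_stableV i b : (gbs_stable i b)^-1 = gbs_stable i (~~ b).
Proof. by case: b; rewrite /gbs_stable ?invgK. Qed.

Lemma gbs_a_order k : expgz gbs_a k = 1 -> k = 0%R.
Proof.
have [F [FM Fa _]] := @gbs_act (fun _ _ => id) (fun _ _ _ => erefl).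
move=> ak; have := Fa k 0%R 0%N; have := Fa 0%R 0%R 0%N.
by rewrite ak expgz0 => -> []; rewrite addr0 add0r.
Qed.

Lemma gbs_conj_noncommute i b d :
    (1 < `|gbs_exp i (~~ b)|)%N -> ~~ (gbs_exp i b %| d)%Z ->
  ~ commute (gbs_stable i b * expgz gbs_a d * (gbs_stable i b)^-1) gbs_a.
Proof.
set e := gbs_exp i b; set e' := gbs_exp i (~~ b) => e'1 ed.
have e0 : e != 0%R := gbs_exp_neq0 i b.
pose rho := `|(d %% e)%Z|%N.
have rho0 : (0 < rho)%N.
  by rewrite absz_gt0; apply: contra ed => /eqP/dvdz_mod0P.
have rhoe : (rho < `|e|)%N.
  by rewrite /rho -ltz_nat gez0_abs ?modz_ge0 // ltz_mod.
(* Starting from [(0, 0)], these values lead the conjugate followed by a to second coordinate 1, and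
   a followed by the conjugate to 2. The code 1 of [(1, 0)] differs from 0 modulo [e'] because
   [|e'| > 1]. *)
pose L := [:: (0, 0); (rho, `|e'|); (`|e|, 1); (`|e| + rho, 2 * `|e'|)]%N.
have [||f [g [fK gK fL]]] := @extend_partial_injection _ L.
- by rewrite /L /= !inE; lia.
- by rewrite /L /= !inE; lia.
pose h i' b' := if i' == i then if b' == b then f else g else id.
have [|F [FM Fa Ft]] := @gbs_act h.
  move=> i' b' x; rewrite /h; case: eqP => // _.
  by case: b' (b) => -[]; rewrite /= ?fK ?gK.
have hb : h i b = f by rewrite /h !eqxx.
have hnb : h i (~~ b) = g by rewrite /h eqxx; case: (b).
have fLE x y : (x, y) \in L -> f x = y by move/fL.
have gLE x y : (x, y) \in L -> g y = x by move/fL=> /= <-; rewrite fK.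
have F1a z c : F gbs_a (z, c) = ((z + 1)%R, c) by rewrite -[gbs_a]expgz1 Fa.
move/(congr1 (fun x => (F x (0%R, 0%N)).2)).
rewrite gbs_stableV !FM !Ft negbK hb hnb -/e -/e' F1a.
have e'0 : (0 < `|e'|)%N by lia.
have e0' : (0 < `|e|)%N by rewrite absz_gt0.
have g0 : g (`|e'| * 0 + `|(0 %% e')%Z|)%N = (0 * `|e| + 0)%N.
  by rewrite mod0z muln0 (gLE 0%N).
have g1 : g (`|e'| * 0 + `|((0 + 1) %% e')%Z|)%N = (1 * `|e| + 0)%N.
  rewrite muln0 -modz_abs modz_small; last lia.
  by rewrite (gLE `|e|%N) ?mul1n ?addn0 // !inE eqxx ?orbT.
have f0 : f (`|e| * 0 + rho)%N = (1 * `|e'| + 0)%N.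
  by rewrite muln0 (fLE _ `|e'|%N) ?mul1n ?addn0 // !inE eqxx ?orbT.
have f1 : f (`|e| * 1 + rho)%N = (2 * `|e'| + 0)%N.
  by rewrite muln1 (fLE _ (2 * `|e'|)%N) ?addn0 // !inE eqxx ?orbT.
rewrite (orbit_mapE e0' g0) (orbit_mapE e0' g1) !Fa.
rewrite !div0z !mul0r !add0r (orbit_mapE e'0 f0) F1a /=.
by rewrite /orbit_map /= addr0 modzMDl f1 addn0 mulnK.
Qed.

(** Since [i != j], the bijections for [t_i] and [t_j] can be prescribed independently; this covers
    [n i = 1], where [gbs_conj_noncommute] does not apply to the inverse of [t_i]. *)
Lemma gbs_conj2_noncommute i j d :
    i != j -> (1 < `|m j|)%N -> ~~ (m i %| d)%Z ->
  ~ commute (gbs_t j * (gbs_t i)^-1 * expgz gbs_a d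
             * (gbs_t j * (gbs_t i)^-1)^-1) gbs_a.
Proof.
move=> ij m1 md.
have mi0 : m i != 0%R := gbs_exp_neq0 i true.
have ni0 : n i != 0%R := gbs_exp_neq0 i false.
have nj0 : n j != 0%R := gbs_exp_neq0 j false.
pose rho := `|(d %% m i)%Z|%N.
have rho0 : (0 < rho)%N.
  by rewrite absz_gt0; apply: contra md => /eqP/dvdz_mod0P.
have rhom : (rho < `|m i|)%N.
  by rewrite /rho -ltz_nat gez0_abs ?modz_ge0 // ltz_mod.
(* The residue modulo [n j] of the position at which both paths arrive before the final [t_j]. *)
pose rho' := `|(((d %/ m i)%Z * n i) %% n j)%Z|%N.
have rhon : (rho' < `|n j|)%N.
  by rewrite /rho' -ltz_nat gez0_abs ?modz_ge0 // ltz_mod.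
have mi_gt0 : (0 < `|m i|)%N by rewrite absz_gt0.
have ni_gt0 : (0 < `|n i|)%N by rewrite absz_gt0.
have nj_gt0 : (0 < `|n j|)%N by rewrite absz_gt0.
have mj_gt0 : (0 < `|m j|)%N by lia.
(* The two paths from [(0, 0)] separate at the first inverse of [t_j], in layers 0 and 2, pass
   through layers 0 and 1, then 1 and 3, and end in layers 1 and 2. *)
pose Li := [:: (0, 0); (`|n i|, rho); (2 * `|n i|, `|m i|);
               (3 * `|n i|, `|m i| + rho)]%N.
pose Lj := [:: (0, 0); (`|n j| + rho', `|m j|); (2 * `|n j|, 1);
               (3 * `|n j| + rho', 2 * `|m j|)]%N.
have [||fi [gi [fiK giK fiL]]] := @extend_partial_injection _ Li.
- by rewrite /Li /= !inE; lia.
- by rewrite /Li /= !inE; lia.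
have [||fj [gj [fjK gjK fjL]]] := @extend_partial_injection _ Lj.
- by rewrite /Lj /= !inE; lia.
- by rewrite /Lj /= !inE; lia.
pose h i' (b : bool) := if i' == i then if b then gi else fi
                        else if i' == j then if b then gj else fj else id.
have [|F [FM Fa Ft]] := @gbs_act h.
  move=> i' b' x; rewrite /h; case: eqP => _; first by case: b' => /=.
  by case: eqP => // _; case: b' => /=.
have hi b : h i b = if b then gi else fi by rewrite /h eqxx.
have hj b : h j b = if b then gj else fj.
  by rewrite /h eqxx eq_sym (negPf ij).
have fiE x y : (x, y) \in Li -> fi x = y by move/fiL.
have giE x y : (x, y) \in Li -> gi y = x by move/fiL=> /= <-; rewrite fiK.
have fjE x y : (x, y) \in Lj -> fj x = y by move/fjL.
have gjE x y : (x, y) \in Lj -> gj y = x by move/fjL=> /= <-; rewrite fjK.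
have F1a z c : F gbs_a (z, c) = ((z + 1)%R, c) by rewrite -[gbs_a]expgz1 Fa.
have Fti s : F (gbs_t i) s = orbit_map (n i) (m i) fi s.
  by rewrite (Ft i false) hi.
have FVti s : F (gbs_t i)^-1 s = orbit_map (m i) (n i) gi s.
  by rewrite (Ft i true) hi.
have Ftj s : F (gbs_t j) s = orbit_map (n j) (m j) fj s.
  by rewrite (Ft j false) hj.
have FVtj s : F (gbs_t j)^-1 s = orbit_map (m j) (n j) gj s.
  by rewrite (Ft j true) hj.
move/(congr1 (fun x => (F x (0%R, 0%N)).2)).
rewrite invgM invgK !FM !Fti !FVti !Ftj !FVtj !F1a add0r.
have gj0 : orbit_map (m j) (n j) gj (0%R, 0%N) = (0%R, 0%N).
  rewrite (@orbit_mapE _ _ _ _ _ 0%N 0%N) ?div0z ?mul0r //.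
  by rewrite mod0z muln0 (gjE 0%N).
have gj1 : orbit_map (m j) (n j) gj (1%R, 0%N) = (0%R, 2%N).
  have lt1 : (0 <= 1%:Z < `|m j|%N%:Z)%R by rewrite ltz_nat m1.
  rewrite (@orbit_mapE _ _ _ _ _ 2%N 0%N) ?(divz_small lt1) ?mul0r //.
  rewrite muln0 -modz_abs modz_small; last lia.
  by rewrite (gjE (2 * `|n j|)%N) ?addn0 // !inE eqxx ?orbT.
have fi0 : orbit_map (n i) (m i) fi (0%R, 0%N) = (0%R, 0%N).
  rewrite (@orbit_mapE _ _ _ _ _ 0%N 0%N) ?div0z ?mul0r //.
  by rewrite mod0z muln0 (fiE _ 0%N).
have fi2 : orbit_map (n i) (m i) fi (0%R, 2%N) = (0%R, 1%N).
  rewrite (@orbit_mapE _ _ _ _ _ 1%N 0%N) ?div0z ?mul0r //.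
  by rewrite mod0z addn0 mulnC (fiE _ `|m i|%N) ?mul1n ?addn0 //
    !inE eqxx ?orbT.
have gi0 : orbit_map (m i) (n i) gi (d, 0%N) = (((d %/ m i)%Z * n i)%R, 1%N).
  rewrite (@orbit_mapE _ _ _ _ _ 1%N 0%N) ?addr0 //.
  by rewrite muln0 -/rho (giE `|n i|%N) ?mul1n ?addn0 // !inE eqxx ?orbT.
have gi1 : orbit_map (m i) (n i) gi (d, 1%N) = (((d %/ m i)%Z * n i)%R, 3%N).
  rewrite (@orbit_mapE _ _ _ _ _ 3%N 0%N) ?addr0 //.
  by rewrite muln1 -/rho (giE (3 * `|n i|)%N) ?addn0 // !inE eqxx ?orbT.
rewrite gj0 gj1 fi0 fi2 !Fa !add0r gi0 gi1.
rewrite /orbit_map /= -/rho'.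
rewrite [(`|n j| * 3)%N]mulnC muln1.
rewrite (fjE _ (2 * `|m j|)%N) ?(fjE _ `|m j|%N) ?mulnK ?divnn ?mj_gt0 //.
  by rewrite !inE eqxx ?orbT.
by rewrite !inE eqxx ?orbT.
Qed.

End Britton.

(** * Compatibility of multiplicative maps with integer powers *)

Section MultiplicativePowers.
Local Open Scope group_scope.
Variables (G H : groupType) (f : {multiplicative G -> H}).

Lemma mult_morph1 : f 1 = 1.
Proof. by apply: (mulgI (f 1)); rewrite -gmulfM !mulg1. Qed.

Lemma mult_morphV g : f g^-1 = (f g)^-1.
Proof. by apply: (mulgI (f g)); rewrite -gmulfM !mulgV mult_morph1. Qed.

Lemma mult_morphXz g k : f (expgz g k) = expgz (f g) k.
Proof.
elim: k => [|j IH|j IH]; first exact: mult_morph1.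
  by rewrite -addn1 PoszD !expgzS gmulfM IH.
by rewrite -addn1 PoszD opprD !expgzB1 gmulfM IH mult_morphV.
Qed.

Lemma mult_morphX g k : f (g ^+ k) = f g ^+ k.
Proof. exact: (mult_morphXz g (Posz k)). Qed.

End MultiplicativePowers.

(** * Conjugate powers of an element in a finite p-group *)

Section FinitePGroups.
Local Open Scope group_scope.
Variables (p : nat) (H : finGroupType).
Hypotheses (p_pr : prime p) (pH : p.-group [set: H]).
Implicit Types (x t : H).

Lemma pgroup_order_pnat x : p.-nat #[x].
Proof. exact: (mem_p_elt pH (in_setT x)). Qed.

(** The p'-part of [k] is coprime to the order of [x], so only the p-part affects the subgroup
    generated. *)
Lemma cycle_expgz_pgroup x (k : int) : k != 0%R ->
  <[expgz x k]> = <[x ^+ (p ^ logn p `|k|)]>.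
Proof.
move=> k0; have ->: <[expgz x k]> = <[x ^+ `|k|]>.
  by case: k {k0} => j //=; rewrite cycleV.
have k_gt0 : (0 < `|k|)%N by rewrite absz_gt0.
rewrite -{1}(partnC p k_gt0) expgM p_part; apply/esym/eqP.
rewrite -[_ == _]/(generator _ _) generator_coprime.
by apply: (@pnat_coprime p); rewrite ?pgroup_order_pnat ?part_pnat.
Qed.

Lemma order_expgp_lt x k : x != 1 -> (0 < k)%N -> (#[x ^+ (p ^ k)] < #[x])%N.
Proof.
move=> x1 k_gt0; rewrite orderXgcd ltn_Pdiv ?order_gt0 //.
have [p1|//] := leqP; case/negP: (x1).
have p_dvd : ~~ (p %| #[x])%N.
  apply/negP=> px; have : (p %| gcdn #[x] (p ^ k))%N.
    by rewrite dvdn_gcd px dvdn_exp.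
  by move/dvdn_leq; rewrite gcdn_gt0 order_gt0 => /(_ isT);
    have := prime_gt1 p_pr; lia.
rewrite -order_eq1 -(part_pnat_id (pgroup_order_pnat x)) p_part.
by rewrite lognE p_pr order_gt0 (negPf p_dvd).
Qed.

(** Conjugate elements have equal orders, whereas raising a non-trivial element to a further
    positive power of [p] lowers its order. *)
Lemma pgroup_conj_expgz_logn x t (n m : int) :
    n != 0%R -> m != 0%R -> t * expgz x n * t^-1 = expgz x m ->
    (logn p `|n| < logn p `|m|)%N ->
  x ^+ (p ^ logn p `|n|) = 1.
Proof.
move=> n0 m0 txt lt_nm; apply/eqP; case: eqVneq => // x1.
have: #[expgz x n] = #[expgz x m].
  have ->: expgz x m = expgz x n ^ t^-1 by rewrite conjgE invgK mulgA.
  by rewrite orderJ.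
rewrite /order !cycle_expgz_pgroup // => eq_ord.
have k_gt0 : (0 < logn p `|m| - logn p `|n|)%N by rewrite subn_gt0.
have := order_expgp_lt x1 k_gt0; rewrite -expgM -expnD subnKC; last exact: ltnW.
by rewrite /order -eq_ord ltnn.
Qed.

(** The [n]-th and [m]-th powers of [x] generate the same cyclic subgroup, and [t] conjugates one to
    the other. *)
Lemma pgroup_conj_expgz_norm x t (n m : int) :
    n != 0%R -> m != 0%R -> t * expgz x n * t^-1 = expgz x m ->
    logn p `|n| = logn p `|m| ->
  t \in 'N(<[x ^+ (p ^ logn p `|m|)]>).
Proof.
move=> n0 m0 txt eq_nm; rewrite -groupV; apply/normP.
by rewrite -{1}eq_nm -!cycle_expgz_pgroup // -cycleJ conjgE invgK mulgA txt.
Qed.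

Lemma norm_cycle_commute x t k :
  t \in 'N(<[x ^+ k]>) -> commute (t * x ^+ k * t^-1) x.
Proof.
move=> tN; have: (x ^+ k) ^ t^-1 \in <[x ^+ k]>.
  by rewrite memJ_norm ?cycle_id // groupV.
rewrite conjgE invgK mulgA => /cycleP[j ->].
by rewrite -expgM; apply/commute_sym/commuteX.
Qed.

Lemma norm_cycleX x t k : t \in 'N(<[x]>) -> t \in 'N(<[x ^+ k]>).
Proof.
apply: (subsetP (char_norms _)).
by rewrite cycle_subgroup_char // cycle_subG mem_cycle.
Qed.

(** Conjugating an odd number of times, the order of [t], inverts [x] yet does nothing; so [x]
    squares to 1 and has odd order. *)
Lemma odd_pgroup_invert x t : odd p -> t * x * t^-1 = x^-1 -> x = 1.
Proof.
move=> p_odd txt; have odd_order (z : H) : odd #[z].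
  exact: (odd_pgroup_odd p_odd (G := <[z]>) (pgroup_order_pnat z)).
have xtj j : x ^ t^-1 ^+ j = if odd j then x^-1 else x.
  elim: j => [|j IH]; first by rewrite conjg1.
  rewrite expgSr conjgM IH /=; case: (odd j) => /=; rewrite ?conjVg;
    by rewrite conjgE invgK mulgA txt ?invgK.
have x2 : x ^+ 2 = 1.
  have := xtj #[t^-1]; rewrite expg_order conjg1 odd_order => xV.
  by rewrite expgS expg1 {1}xV mulVg.
apply/eqP; rewrite -order_eq1 -dvdn1.
have : (#[x] %| gcdn 2 #[x])%N by rewrite dvdn_gcd order_dvdn x2 eqxx dvdnn.
by have /eqP -> : coprime 2 #[x] by rewrite coprime2n.
Qed.

End FinitePGroups.

(** * Necessity of the condition on the exponents *)

Section Necessity.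
Local Open Scope group_scope.
Variables (p : nat) (r : nat) (n m : 'I_r -> int).
Hypotheses (p_pr : prime p) (r_ge2 : (2 <= r)%N).
Hypotheses (n0 : forall i, n i <> 0%R) (m0 : forall i, m i <> 0%R).
Hypothesis nm : forall i, (0 < n i <= `|m i|)%R.
Hypothesis nm1 : forall i, (n i, `|m i|)%R <> (1, 1)%R.
Hypothesis Gp : residually_finite_p_group p (gbs n m).

Let a := gbs_a n m.
Let t := gbs_t n m.
Let m_gt1 i : (1 < `|m i|)%N.
Proof.
move: (nm i) (@nm1 i); case: (n i) => // -[|[|k]] //; last by lia.
by move=> m_gt0 m1; rewrite ltnNge; apply/negP=> m_le1; apply: m1; congr (_, _);
  lia.
Qed.

Lemma rfp_eq (g h : gbs n m) :
    (forall (H : finGroupType) (f : {multiplicative gbs n m -> H}),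
       p.-group [set: H] -> f g = f h) -> g = h.
Proof.
move=> fgh; case: (eqVneq (g * h^-1) 1) => [/mulg1_eq /invg_inj -> //|/eqP/Gp].
case=> H [f [pH []]].
by rewrite gmulfM (fgh H f pH) -gmulfM mulgV mult_morph1.
Qed.

Lemma rfp_commute (g h : gbs n m) :
    (forall (H : finGroupType) (f : {multiplicative gbs n m -> H}),
       p.-group [set: H] -> commute (f g) (f h)) -> commute g h.
Proof. by move=> fgh; apply: rfp_eq => H f pH; rewrite !gmulfM; apply: fgh. Qed.

Let rel_morph (H : finGroupType) (f : {multiplicative gbs n m -> H}) i :
  f (t i) * expgz (f a) (n i) * (f (t i))^-1 = expgz (f a) (m i).
Proof. by rewrite -!mult_morphXz -mult_morphV -!gmulfM gbs_relation. Qed.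

Let relV_morph (H : finGroupType) (f : {multiplicative gbs n m -> H}) i :
  (f (t i))^-1 * expgz (f a) (m i) * f (t i) = expgz (f a) (n i).
Proof. by rewrite -rel_morph !mulgA mulVg mul1g mulgVK. Qed.

Let expa_eq1 k : (0 < k)%N -> a ^+ k <> 1.
Proof. by move=> k_gt0 /(@gbs_a_order r n m n0 m0 (Posz k)); lia. Qed.

Let n_neq0 i : n i != 0%R. Proof. exact/eqP/n0. Qed.
Let m_neq0 i : m i != 0%R. Proof. exact/eqP/m0. Qed.

(** Otherwise a non-trivial power of a would die in every finite p-quotient; the two inequalities
    are handled by [t_i] and its inverse. *)
Lemma rfp_logn_eq i : logn p `|n i| = logn p `|m i|.
Proof.
case: (ltngtP (logn p `|n i|) (logn p `|m i|)) => // lt_nm.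
  case: (@expa_eq1 (p ^ logn p `|n i|)); first by rewrite expn_gt0 prime_gt0.
  apply: rfp_eq => H f pH; rewrite mult_morphX mult_morph1.
  exact: (pgroup_conj_expgz_logn p_pr pH _ _ (rel_morph f i) lt_nm).
case: (@expa_eq1 (p ^ logn p `|m i|)); first by rewrite expn_gt0 prime_gt0.
apply: rfp_eq => H f pH; rewrite mult_morphX mult_morph1.
apply: (pgroup_conj_expgz_logn (t := (f (t i))^-1) p_pr pH _ _ _ lt_nm) => //.
by rewrite invgK; apply: relV_morph.
Qed.

Lemma rfp_norm (H : finGroupType) (f : {multiplicative gbs n m -> H}) i :
  p.-group [set: H] -> f (t i) \in 'N(<[f a ^+ (p ^ logn p `|m i|)]>).
Proof.
move=> pH; apply: (pgroup_conj_expgz_norm pH _ _ (rel_morph f i)) => //.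
exact: rfp_logn_eq.
Qed.

Lemma rfp_n_eq i : n i = (p ^ logn p `|m i|)%N%:Z.
Proof.
have n_dvd : (`|n i| %| p ^ logn p `|m i|)%N.
  apply/idPn=> ndvd; case: (gbs_conj_noncommute (i := i) (b := false)
    (d := Posz (p ^ logn p `|m i|)) n0 m0 (m_gt1 i) ndvd).
  apply: rfp_commute => H f pH; rewrite !gmulfM mult_morphV mult_morphXz.
  exact/norm_cycle_commute/rfp_norm.
have dvd_n : (p ^ logn p `|m i| %| `|n i|)%N.
  by rewrite -rfp_logn_eq pfactor_dvdnn.
have ->: n i = `|n i|%N by have := nm i; lia.
by congr Posz; apply/eqP; rewrite eqn_dvd n_dvd.
Qed.

Lemma rfp_m_eq i : `|m i|%N = (p ^ logn p `|m i|)%N.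
Proof.
apply/eqP; rewrite eqn_dvd pfactor_dvdnn andbT; apply/idPn=> m_ndvd.
have [n_gt1|n_le1] := ltnP 1 `|n i|.
  case: (gbs_conj_noncommute (i := i) (b := true)
    (d := Posz (p ^ logn p `|m i|)) n0 m0 n_gt1 m_ndvd).
  apply: rfp_commute => H f pH; rewrite !gmulfM !mult_morphV mult_morphXz.
  by apply/norm_cycle_commute; rewrite groupV; apply: rfp_norm.
(* Now [t_i] normalises the image of the subgroup generated by a in every finite p-quotient, so the
   argument needs a second stable letter [t_j]. *)
have n1 : `|n i|%N = 1%N by move: (nm i); lia.
have logm : logn p `|m i| = 0%N by rewrite -rfp_logn_eq n1 logn1.
have [j ij] : exists j, i != j.
  have r_gt0 : (0 < r)%N by lia.
  have [i0|i0] := eqVneq i (Ordinal r_gt0); last by exists (Ordinal r_gt0).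
  by exists (Ordinal r_ge2); rewrite i0.
(* [m i] is prime to [p] and not a unit, so it divides no power of [p]. *)
have mi_ndvd : ~~ (m i %| (p ^ logn p `|m j|)%N%:Z)%Z.
  apply/negP; rewrite /dvdz /= => /(dvdn_pfactor _ _ p_pr)[k _ mk].
  by move: (m_gt1 i) logm; rewrite mk pfactorK // => /[swap] ->.
case: (gbs_conj2_noncommute n0 m0 ij (m_gt1 j) mi_ndvd).
apply: rfp_commute => H f pH; rewrite !(gmulfM, mult_morphV) mult_morphXz.
apply/norm_cycle_commute; rewrite groupM ?groupV ?rfp_norm //.
by apply: norm_cycleX; have := rfp_norm f i pH; rewrite logm expn0 expg1.
Qed.

Lemma rfp_exponents :
  (forall i, n i = m i /\ m i = (p ^ logn p `|m i|)%N%:Z) \/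
  (p = 2%N /\
   forall i, n i = `|m i|%R /\ `|m i|%R = (2 ^ logn p `|m i|)%N%:Z).
Proof.
have [p2|p_odd] := even_prime p_pr.
  right; split=> // i; rewrite -abszE rfp_n_eq -rfp_m_eq.
  by split=> //; rewrite {1}(rfp_m_eq i) {1}p2.
left=> i; suff mn : n i = m i by split=> //; rewrite -{1}mn rfp_n_eq.
have m_abs : `|m i|%N%:Z = n i by rewrite rfp_n_eq -rfp_m_eq.
case: (ltrP 0%R (m i)) => m_sgn; first by rewrite -m_abs; lia.
have mn : (m i = - n i)%R by rewrite -m_abs; lia.
have/n0 : n i = 0%R => //.
apply: (gbs_a_order n0 m0); apply: rfp_eq => H f pH.
rewrite mult_morphXz mult_morph1.
apply: (odd_pgroup_invert pH p_odd (t := f (t i))).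
by rewrite rel_morph mn expgzN.
Qed.

End Necessity.

(** * Groups of congruence units over a ring in which p is nilpotent *)

Section Congruence.
Variables (R : finNzRingType) (p k : nat) (pk0 : p%:R ^+ k = 0 :> R).

(* [x : cong_units] stands for the congruence unit [1 + p x]. *)
Definition cong_units of p%:R ^+ k = 0 :> R : Type := R.
Local Notation C := (cong_units pk0).
HB.instance Definition _ := Finite.copy C R.

Definition cong_val (x : R) : R := 1 + x *+ p.
(** The product of 1 + px and 1 + py, less 1, with one factor p divided out formally. This is a
    group law on all of [R], of order [#|R|], even where [cong_val] is not injective. *)
Definition cong_mul (x y : R) : R := x + y + (x * y) *+ p.
(** The inverse of 1 + px is the geometric sum s in -px, finite since p is nilpotent, and s = 1 -
    psx. *)
Definition cong_inv (x : R) : R :=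
  - ((\sum_(i < k) (- (x *+ p)) ^+ i) * x).

Lemma cong_valM x y : cong_val (cong_mul x y) = cong_val x * cong_val y.
Proof.
rewrite /cong_val /cong_mul mulrDl mul1r mulrDr mulr1 !mulrnDl mulrnAl.
by rewrite mulrnAr !addrA [RHS](ACl (1*3*2*4)).
Qed.

Fact cong_mulA : associative cong_mul.
Proof.
move=> x y z; rewrite /cong_mul !mulrDl !mulrDr !mulrnDl mulrnAl mulrnAr mulrA.
by rewrite !addrA [RHS](ACl (1*2*4*6*3*5*7)).
Qed.

Fact cong_mul0 : left_id 0 cong_mul.
Proof. by move=> x; rewrite /cong_mul mul0r mul0rn add0r addr0. Qed.

Fact cong_mulV : left_inverse 0 cong_inv cong_mul.
Proof.
move=> x; rewrite /cong_mul /cong_inv; set s := \sum_(i < k) _.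
have cs : s * x = x * s.
  rewrite mulr_suml mulr_sumr; apply: eq_bigr => i _; apply/commr_sym/commrX.
  by apply/commrN/commrMn.
have s1 : (1 + x *+ p) * s = 1.
  apply: oppr_inj; rewrite -mulNr opprD addrC -subrX1 -mulNrn exprMn_n.
  by rewrite -mulr_natr natrX pk0 mulr0 sub0r.
rewrite mulNr mulNrn cs -[X in _ + X + _]mulr1 -s1 mulrDl mul1r mulrDr.
by rewrite mulrnAl mulrnAr addKr -[x * s * x]mulrA cs subrr.
Qed.

HB.instance Definition _ :=
  Finite_isGroup.Build C cong_mulA cong_mul0 cong_mulV.

Lemma cong_mulE (x y : C) : (x * y)%g = cong_mul x y. Proof. by []. Qed.

Lemma cong_val_mulg (x y : C) :
  cong_val (x * y)%g = cong_val x * cong_val y.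
Proof. exact: cong_valM. Qed.

End Congruence.

(** * Affine maps with slope congruent to 1 modulo p *)

Section Affine.
Variables (R : finNzRingType) (p k : nat) (pk0 : p%:R ^+ k = 0 :> R).
Local Notation C := (cong_units pk0).

Definition affine : Type := (C * R)%type.
Local Notation A := affine.
HB.instance Definition _ := Finite.copy A (C * R)%type.

Definition aff_act (x : A) (z : R) : R := x.2 + cong_val p x.1 * z.
Definition aff_mul (x y : A) : A := ((x.1 * y.1)%g, aff_act x y.2).
Definition aff_inv (x : A) : A :=
  ((x.1)^-1%g, - (cong_val p (x.1)^-1%g * x.2)).

Lemma aff_actM x y z : aff_act (aff_mul x y) z = aff_act x (aff_act y z).
Proof. by rewrite /aff_act /= cong_val_mulg [in RHS]mulrDr mulrA addrA. Qed.

Fact aff_mulA : associative aff_mul.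
Proof. by move=> x y z; congr (_, _); rewrite /= ?mulgA ?aff_actM. Qed.

Fact aff_mul1 : left_id (1%g, 0) aff_mul.
Proof.
move=> [c z]; congr (_, _); rewrite /= ?mul1g // /aff_act /= add0r.
by rewrite /cong_val mul0rn addr0 mul1r.
Qed.

Fact aff_mulV : left_inverse (1%g, 0) aff_inv aff_mul.
Proof. by move=> [c z]; congr (_, _); rewrite /= ?mulVg // /aff_act addNr. Qed.

HB.instance Definition _ := Finite_isGroup.Build A aff_mulA aff_mul1 aff_mulV.

Lemma aff_mulE (x y : A) : (x * y)%g = ((x.1 * y.1)%g, aff_act x y.2).
Proof. by []. Qed.

Lemma aff_act_mul (x y : A) z : aff_act (x * y)%g z = aff_act x (aff_act y z).
Proof. exact: aff_actM. Qed.

Lemma aff_act1 z : aff_act 1%g z = z.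
Proof. by rewrite /aff_act /cong_val /= mul0rn addr0 mul1r add0r. Qed.

Lemma aff_actK (x : A) : cancel (aff_act x) (aff_act x^-1%g).
Proof. by move=> z; rewrite -aff_act_mul mulVg aff_act1. Qed.

Lemma aff_fix_expgz (x : A) z e : aff_act x z = z -> aff_act (expgz x e) z = z.
Proof.
move=> xz; have xVz : aff_act x^-1%g z = z by rewrite -{1}xz aff_actK.
elim: e => [|j IH|j IH]; first exact: aff_act1.
  by rewrite -addn1 PoszD expgzS aff_act_mul xz.
by rewrite -addn1 PoszD opprD expgzB1 aff_act_mul xVz.
Qed.

Lemma affine_pgroup q : q.-nat #|R| -> (q.-group [set: A])%g.
Proof.
by move=> qR; rewrite /pgroup cardsT card_prod pnatM; apply/andP.
Qed.

End Affine.

(** * The regular wreath product *)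

Section Wreath.
Variables P U : finGroupType.

Definition wreath : Type := (P * {ffun P -> U})%type.
HB.instance Definition _ := Finite.copy wreath (P * {ffun P -> U})%type.

Local Open Scope group_scope.

(** At 1, a product multiplies the decorations of its factors, each read at the product in [P] of
    the factors to its right. *)
Definition wreath_mul (x y : wreath) : wreath :=
  (x.1 * y.1, [ffun g => x.2 (y.1 * g) * y.2 g]).
Definition wreath_inv (x : wreath) : wreath :=
  (x.1^-1, [ffun g => (x.2 (x.1^-1 * g))^-1]).

Fact wreath_mulA : associative wreath_mul.
Proof.
move=> x y z; congr (_, _); first by rewrite /= mulgA.
by apply/ffunP=> g; rewrite !ffunE !mulgA.
Qed.

Fact wreath_mul1 : left_id (1, [ffun=> 1]) wreath_mul.
Proof.
case=> a u; congr (_, _); first exact: mul1g.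
by apply/ffunP=> g; rewrite !ffunE mul1g.
Qed.

Fact wreath_mulV : left_inverse (1, [ffun=> 1]) wreath_inv wreath_mul.
Proof.
case=> a u; congr (_, _); first exact: mulVg.
by apply/ffunP=> g; rewrite !ffunE mulKg mulVg.
Qed.

HB.instance Definition _ :=
  Finite_isGroup.Build wreath wreath_mulA wreath_mul1 wreath_mulV.

Lemma wreath1E (x y : wreath) : (x * y).1 = x.1 * y.1. Proof. by []. Qed.

Lemma wreath2E (x y : wreath) g : (x * y).2 g = x.2 (y.1 * g) * y.2 g.
Proof. by rewrite ffunE. Qed.

Lemma wreath_expgz1 (x : wreath) e : (expgz x e).1 = expgz x.1 e.
Proof.
elim: e => [|j IH|j IH] //.
  by rewrite -addn1 PoszD !expgzS wreath1E IH.
by rewrite -addn1 PoszD opprD !expgzB1 wreath1E IH.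
Qed.

Lemma wreath_expgz2 (x : wreath) e :
    (forall g, x.2 (x.1 * g) = x.2 g) ->
  forall g, (expgz x e).2 g = expgz (x.2 g) e.
Proof.
move=> xinv; elim: e => [|j IH|j IH] g; first by rewrite ffunE.
  by rewrite -addn1 PoszD !expgzS wreath2E IH xinv.
rewrite -addn1 PoszD opprD !expgzB1 wreath2E IH ffunE.
by rewrite -(xinv (_ * g)) mulVKg.
Qed.

Lemma wreath_pgroup p :
  p.-group [set: P] -> p.-group [set: U] -> p.-group [set: wreath].
Proof.
rewrite /pgroup !cardsT card_prod card_ffun => pP pU.
by rewrite pnatM pP pnatX pU.
Qed.

End Wreath.

(** * Arithmetic modulo a prime power *)

Section ZpPrimePower.
Variables (p k : nat).
Hypotheses (p_pr : prime p) (k_gt0 : (0 < k)%N).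

(** ['Z_q] is the ring of integers modulo [q] only for [q > 1]. *)
Lemma expn_prime_gt1 : (1 < p ^ k)%N.
Proof. by rewrite -{1}(exp1n k) ltn_exp2r // prime_gt1. Qed.

Lemma natr_Zp_eq0 j : (j%:R == 0 :> 'Z_(p ^ k)) = (p ^ k %| j)%N.
Proof. by rewrite -val_eqE /= val_Zp_nat ?expn_prime_gt1. Qed.

Lemma intr_Zp_eq0 (j : int) : (j%:~R == 0 :> 'Z_(p ^ k)) = (p ^ k %| `|j|)%N.
Proof.
by rewrite -natr_Zp_eq0; case: j => j //; rewrite NegzE mulrNz oppr_eq0 abszN.
Qed.

Lemma card_Zp_pnat : p.-nat #|'Z_(p ^ k)|.
Proof. by rewrite card_ord Zp_cast ?expn_prime_gt1 // pnatX pnat_id. Qed.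

Lemma natrX_Zp_eq0 : p%:R ^+ k = 0 :> 'Z_(p ^ k).
Proof. by apply/eqP; rewrite -natrX natr_Zp_eq0. Qed.

Lemma natrX_mx_Zp_eq0 j : p%:R ^+ k = 0 :> 'M['Z_(p ^ k)]_j.+1.
Proof.
rewrite -natrX -(rmorph_nat (@scalar_mx _ _)) natrX natrX_Zp_eq0.
exact: raddf0.
Qed.

End ZpPrimePower.

(** * Residual p-finiteness of free groups *)

Section FreeGroups.
Variables (p : nat) (p_pr : prime p) (Y : eqType).
Implicit Types (D : seq (Y * int)).

Definition eval_syllables (G : groupType) (h : Y -> G) D : G :=
  foldr (fun u x => (expgz (h u.1) u.2 * x)%g) 1%g D.

Definition reduced_syllables D :=
  sorted (fun u v => u.1 != v.1) D && all (fun u => u.2 != 0) D.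

(** When [x] squares to zero the cross term of [cong_mul] vanishes, so powers are integer
    multiples. *)
Lemma cong_val_expgz (R : finNzRingType) k (pk0 : p%:R ^+ k = 0 :> R)
    (x : cong_units pk0) e :
  (x : R) * x = 0 -> cong_val p (expgz x e) = 1 + ((x : R) *~ e) *+ p.
Proof.
move=> xx0; suff -> : expgz x e = (x : R) *~ e by [].
have mulE j : cong_mul p ((x : R) *~ j) x = (x : R) *~ (j + 1).
  by rewrite /cong_mul mulrzAl xx0 mul0rz mul0rn addr0 mulrzDr mulr1z.
have VE : (x^-1)%g = - x :> R.
  apply: (@mulgI _ x); rewrite mulgV cong_mulE /cong_mul mulrN xx0 subrr.
  by rewrite oppr0 mul0rn addr0.
elim: e => [|j IH|j IH] //.
  by rewrite -addn1 PoszD expgzS IH; apply: mulE.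
rewrite -addn1 PoszD opprD expgzB1 IH VE cong_mulE /cong_mul.
by rewrite mulrN mulrzAl xx0 mul0rz oppr0 mul0rn addr0 mulrzBr mulr1z.
Qed.

(* Over Z/p^k with large k, the letter y acts by 1 + p N_y, where N_y has an
   entry 1 at (i, i+1) for each syllable i with letter y. The entry (0, K) of
   the product of K syllables is p^K times the product of the exponents. *)
Lemma free_group_residually_p D : reduced_syllables D -> D != [::] ->
  exists (U : finGroupType) (h : Y -> U),
    (p.-group [set: U])%g /\ eval_syllables h D != 1%g.
Proof.
case/andP=> D_adj D_neq0 D_nil; pose K := size D.
pose c := \prod_(u <- D) (u.2 *+ p).
have c0 : c != 0.
  rewrite prodf_seq_neq0; apply: sub_all D_neq0 => u u0 /=.
  by rewrite mulrn_eq0 negb_or u0 -lt0n prime_gt0.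
(* With this choice [p ^ k] exceeds [|c|], so the non-zero [c] survives modulo [p ^ k]. *)
pose k := `|c|%N; have k_gt0 : (0 < k)%N by rewrite absz_gt0.
pose R := 'Z_(p ^ k); pose pk0 := natrX_mx_Zp_eq0 p_pr k_gt0 K.
pose lab i := nth None (map (fun u => Some u.1) D) i.
pose h (y : Y) : cong_units pk0 :=
  \matrix_(i, j) ((j == i.+1 :> nat) && (lab i == Some y))%:R.
exists (cong_units pk0), h; split.
  by rewrite /pgroup cardsT card_mx pnatX card_Zp_pnat.
have lab_adj i : (i.+1 < K)%N -> lab i != lab i.+1.
  have: sorted (fun v w => v != w) (map (fun u => Some u.1) D).
    by rewrite sorted_map.
  by move/(sortedP None); rewrite size_map; apply.
(* Adjacent syllables carry distinct letters, so the entries at (i, i+1) and (i+1, i+2) never belong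
   to the same letter. *)
have hh y : (h y : 'M[R]_K.+1) * h y = 0.
  apply/matrixP=> i j; rewrite !mxE big1 // => l _; rewrite !mxE -natrM mulnb.
  case: eqP => //= li; case: eqP => //= yi; case: eqP => //= jl.
  case: eqP => // yl; have /lab_adj : (i.+1 < K)%N by rewrite -li -ltnS -jl.
  by rewrite yi -li yl eqxx.
have [M [M0 McE MD]] : exists M : seq (Y * int) -> 'M[R]_K.+1,
    [/\ M [::] = 1,
        forall u s, M (u :: s) = (1 + (h u.1 : 'M[R]_K.+1) *~ u.2 *+ p) * M s
      & M D = cong_val p (eval_syllables h D)].
  exists (fun s => cong_val p (eval_syllables h s)); split=> // [|u s].
    by rewrite /cong_val mul0rn addr0.
  by rewrite /= cong_val_mulg cong_val_expgz.
(* Induction on the suffix [s] starting at position [i], in the last column. The zeros above row [i]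
   remove the contribution of the identity matrix when a syllable is prepended. *)
have entry s : forall i : nat, drop i D = s -> (i <= K)%N ->
    M s (inord i) ord_max = (\prod_(u <- s) (u.2 *+ p))%:~R /\
    forall j : nat, (j < i)%N -> M s (inord j) ord_max = 0.
  elim: s => [|u s IH] i Ds iK.
    have iKE : i = K.
      apply/eqP; rewrite eqn_leq iK /=.
      by have := size_drop i D; rewrite Ds /= => /esym/eqP; rewrite subn_eq0.
    rewrite M0 big_nil; split=> [|j ji].
      by rewrite mxE iKE -val_eqE /= inordK ?eqxx.
    by rewrite mxE -val_eqE /= inordK ?ltnS 1?ltnW -?iKE // ltn_eqF.
  have iltK : (i < K)%N.
    by rewrite ltnNge; apply/negP=> /drop_oversize; rewrite Ds.
  have labi : lab i = Some u.1.
    rewrite /lab (nth_map u) //; congr (Some _.1).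
    by rewrite -[i]addn0 -nth_drop Ds.
  have Ds' : drop i.+1 D = s by rewrite -add1n -drop_drop Ds /= drop0.
  have [IH1 IH2] := IH _ Ds' iltK.
  have stepE (j : nat) : (j < K)%N -> M (u :: s) (inord j) ord_max =
      M s (inord j) ord_max
      + ((lab j == Some u.1)%:R * M s (inord j.+1) ord_max) *~ u.2 *+ p.
    move=> jK; rewrite McE mulrDl mul1r [_ *+ p * _]mulrnAl mulrzAl mxE.
    congr (_ + _).
    rewrite mulmxnE -scaler_int mxE mulrzl; congr (_ *~ _ *+ _).
    rewrite mxE (bigD1 (inord j.+1)) //= big1 ?addr0 => [|l l_neq].
      by rewrite mxE !inordK ?eqxx // ltnS ltnW.
    rewrite mxE inordK ?ltnS 1?ltnW //; case: eqP => [lj|]; last first.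
      by rewrite mul0r.
    by case/eqP: l_neq; apply/val_inj; rewrite /= lj inordK.
  split=> [|j ji].
    rewrite stepE // IH2 // add0r labi eqxx mul1r IH1 big_cons.
    by rewrite intrM rmorphMn mulrnAl mulrzl.
  rewrite stepE; last exact: ltn_trans ji iltK.
  by rewrite !IH2 ?mulr0 ?mul0rz ?mul0rn ?addr0 // ltnS 1?ltnW.
apply/negP=> /eqP D1.
have [] := entry D 0%N (drop0 D) (leq0n K); rewrite MD D1.
rewrite /cong_val mul0rn addr0 mxE -val_eqE /= inordK // -/c => /esym/eqP.
have K_gt0 : (0 < K)%N by rewrite lt0n size_eq0.
rewrite (ltn_eqF K_gt0) intr_Zp_eq0 // -/k => /(dvdn_leq k_gt0).
by rewrite leqNgt ltn_expl ?prime_gt1.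
Qed.

End FreeGroups.

(** * Normal forms when each m_i is n_i up to sign *)

Section NormalForm.
Local Open Scope group_scope.
Variables (r : nat) (n m s : 'I_r -> int).
Hypothesis mE : forall i, m i = (s i * n i)%R.
Hypothesis ss1 : forall i, (s i * s i = 1)%R.

Let a := gbs_a n m.

(** Since [x ^ y] is y^-1 x y, this is the element t_(i,z) = a^z t_i a^-z. *)
Definition gbs_conj (y : 'I_r * int) : gbs n m :=
  gbs_t n m y.1 ^ expgz a (- y.2)%R.

Definition gbs_adj (u v : ('I_r * int) * int) : bool :=
  ~~ ((u.1.1 == v.1.1) && (n u.1.1 %| u.1.2 - v.1.2)%Z).

Definition gbs_reduced (L : seq (('I_r * int) * int)) : bool :=
  sorted gbs_adj L && all (fun u => u.2 != 0%R) L.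

Lemma gbs_t_shift i l :
  gbs_t n m i * expgz a (n i * l)%R = expgz a (s i * (n i * l))%R * gbs_t n m i.
Proof.
have := gbs_relation n m i; rewrite -/a => rel.
rewrite mulrA -mE !expgzM -rel.
have ->: gbs_t n m i * expgz a (n i) * (gbs_t n m i)^-1
         = expgz a (n i) ^ (gbs_t n m i)^-1 by rewrite conjgE invgK mulgA.
by rewrite expgzJ conjgE invgK mulgA mulgVK.
Qed.

Lemma gbs_conj_shift i z l e : e = 1%R \/ e = (-1)%R ->
  expgz (gbs_conj (i, z)) e * expgz a (n i * l)%R =
  expgz a (s i * (n i * l))%R * expgz (gbs_conj (i, z)) e.
Proof.
have shift k : gbs_conj (i, z) * expgz a (n i * k)%R =
    expgz a (s i * (n i * k))%R * gbs_conj (i, z).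
  rewrite /gbs_conj conjgE /= expgzN invgK -!mulgA -expgzN -expgzD addrC expgzD.
  by rewrite [X in _ * X]mulgA gbs_t_shift !mulgA -!expgzD addrC.
case=> ->; first by rewrite expgz1.
rewrite expgzN1; apply: (mulgI (gbs_conj (i, z))); rewrite mulVKg mulgA.
have ->: (s i * (n i * l) = n i * (s i * l))%R by rewrite mulrCA.
rewrite shift -mulgA mulgV mulg1; congr expgz.
by rewrite mulrCA [(s i * (s i * l))%R]mulrA ss1 mul1r.
Qed.

(** Conjugation by a^(n_i l) turns t_(i,w) into t_(i,z); moving the right-hand power of a to the
    left multiplies its exponent by the sign [s i]. *)
Lemma gbs_conj_merge i z w l e : e = 1%R \/ e = (-1)%R ->
    z = (w + n i * l)%R ->
  expgz (gbs_conj (i, z)) e =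
  expgz a ((1 - s i) * (n i * l))%R * expgz (gbs_conj (i, w)) e.
Proof.
move=> e1 ->; have -> : gbs_conj (i, w + n i * l)%R =
    gbs_conj (i, w) ^ expgz a (n i * - l)%R.
  by rewrite /gbs_conj -conjgM -expgzD /= opprD mulrN.
rewrite expgzJ conjgE gbs_conj_shift // mulgA -expgzN -expgzD.
by congr (expgz a _ * _); ring.
Qed.

(** If the new syllable clashes with the head, [gbs_conj_merge] gives it the index of the head; the
    exponents add up, and a zero sum deletes the head. *)
Lemma gbs_reduced_cons i z e L : e = 1%R \/ e = (-1)%R -> gbs_reduced L ->
  exists k L', gbs_reduced L' /\
    expgz (gbs_conj (i, z)) e * eval_syllables gbs_conj L =
    expgz a k * eval_syllables gbs_conj L'.
Proof.
move=> e1; have e0 : e != 0%R by case: e1 => ->.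
case: L => [|[[j w] e'] L] redL.
  exists 0%R, [:: ((i, z), e)]; rewrite expgz0 mul1g /=; split=> //.
  by rewrite /gbs_reduced /= e0.
have [/andP[/= /eqP ij /dvdzP[l zw]]|nadj] :=
    boolP ((i == j) && (n i %| z - w)%Z); last first.
  exists 0%R, [:: ((i, z), e), ((j, w), e') & L].
  rewrite expgz0 mul1g; split=> //.
  case/andP: redL => srt nz; apply/andP; split; last by rewrite /= e0.
  by rewrite /= andbC; apply/andP.
rewrite -{j}ij in redL *.
have zE : z = (w + n i * l)%R by rewrite mulrC -zw addrC subrK.
exists ((1 - s i) * (n i * l))%R; rewrite (gbs_conj_merge e1 zE) -mulgA.
case/andP: redL => srt /= /andP[e'0 nz].
have [ee'|ee'] := eqVneq (e + e')%R 0%R.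
  exists L; split; first by rewrite /gbs_reduced (path_sorted srt).
  by congr (_ * _); rewrite mulgA -expgzD ee' expgz0 mul1g.
exists (((i, w), (e + e')%R) :: L); split.
  by rewrite /gbs_reduced /= ee' nz andbT andbT; case: (L) srt.
by congr (_ * _); rewrite /= expgzD mulgA.
Qed.

(** Induction on left multiplication by generators, using t_i^e a^k = a^k t_(i,-k)^e. *)
Lemma gbs_normal_form (g : gbs n m) :
  exists k L, gbs_reduced L /\ g = expgz a k * eval_syllables gbs_conj L.
Proof.
elim/pres_gen_ind: g => [|x g [k [L [redL ->]]]].
  by exists 0%R, [::]; rewrite /= mulg1.
case: x => [i|].
  have tE e : e = 1%R \/ e = (-1)%R -> exists k' L', gbs_reduced L' /\
      expgz (gbs_t n m i) e * (expgz a k * eval_syllables gbs_conj L) =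
      expgz a k' * eval_syllables gbs_conj L'.
    move=> e1; have [k' [L' [redL' eqL']]] :=
      gbs_reduced_cons i (- k)%R e1 redL.
    exists (k + k')%R, L'; split=> //; rewrite expgzD -mulgA -eqL'.
    by rewrite /gbs_conj /= opprK expgzJ conjgE !mulgA mulgV mul1g.
  by split; [rewrite -[pres_gen _ _]expgz1 | rewrite -expgzN1]; apply: tE;
    [left | right].
split; [exists (1 + k)%R, L | exists (-1 + k)%R, L]; split=> //.
  by rewrite expgzD expgz1 mulgA.
by rewrite expgzD expgzN1 mulgA.
Qed.

End NormalForm.

(** * Sufficiency: separating normal forms in wreath products of p-groups *)

Section Sufficiency.
Local Open Scope group_scope.
Variables (p r : nat) (n m c : 'I_r -> int) (sg : 'I_r -> nat).
Hypothesis p_pr : prime p.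
Hypothesis nE : forall i, n i = (p ^ sg i)%N%:Z.
Hypothesis mE : forall i, m i = ((1 + c i *+ p) * n i)%R.
Hypothesis cc1 : forall i, ((1 + c i *+ p) * (1 + c i *+ p) = 1 :> int)%R.

Section Quotient.
Variables (N : nat) (N_gt0 : (0 < N)%N) (sgN : forall i, (sg i <= N)%N).

Let R := 'Z_(p ^ N).
Let pN0 := natrX_Zp_eq0 p_pr N_gt0.
Let P := affine pN0.
Let C := cong_units pN0.

Definition aff_trans (z : R) : P := (1 : C, z).
Definition aff_alpha : P := aff_trans 1%R.
Definition aff_tau (i : 'I_r) : P := ((c i)%:~R%R : C, 0%R : R).
Definition aff_conj (y : 'I_r * int) : P :=
  aff_tau y.1 ^ expgz aff_alpha (- y.2)%R.

Lemma aff_transD z w : aff_trans z * aff_trans w = aff_trans (z + w)%R.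
Proof.
by rewrite aff_mulE mulg1 /aff_act /cong_val /= mul0rn addr0 mul1r.
Qed.

Lemma aff_alphaXz k : expgz aff_alpha k = aff_trans k%:~R%R.
Proof.
have VE : aff_alpha^-1 = aff_trans (-1)%R.
  by apply: (mulgI aff_alpha); rewrite mulgV aff_transD subrr.
elim: k => [|j IH|j IH] //.
  by rewrite -addn1 PoszD expgzS IH aff_transD intrD.
by rewrite -addn1 PoszD opprD expgzB1 IH VE aff_transD intrD.
Qed.

Lemma aff_act_alpha k z : aff_act (expgz aff_alpha k) z = (z + k%:~R)%R.
Proof.
by rewrite aff_alphaXz /aff_act /cong_val /= mul0rn addr0 mul1r addrC.
Qed.

Lemma aff_relation i : aff_tau i * expgz aff_alpha (n i) =
  expgz aff_alpha (m i) * aff_tau i.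
Proof.
rewrite !aff_alphaXz !aff_mulE mulg1 mul1g; congr (_, _).
rewrite /aff_act /= mulr0 addr0 add0r mE intrM; congr (_ * _)%R.
by rewrite /cong_val intrD rmorphMn.
Qed.

(** [aff_tau] fixes 0, and the conjugation translates this fixed point. *)
Lemma aff_conj_fix y : aff_act (aff_conj y) y.2%:~R%R = y.2%:~R%R.
Proof.
rewrite /aff_conj conjgE -expgzN opprK !aff_act_mul !aff_act_alpha.
by rewrite intrN subrr /aff_act /= mulr0 addr0 add0r.
Qed.

(* Multiplication by [p ^ (N - e)] in Z/p^N records a class modulo [p ^ e]. *)
Definition aff_label (y : 'I_r * int) (x : P) : 'I_r * R :=
  (y.1, ((p ^ (N - sg y.1))%:R * aff_act (x^-1%g : P) y.2%:~R)%R).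

Lemma aff_act_cong (k z z' : R) (x : P) : (k * z = k * z')%R ->
  (k * aff_act x z = k * aff_act x z')%R.
Proof. by move=> kz; rewrite /aff_act !mulrDr !(mulrCA k) kz. Qed.

(** Translation by [n i = p ^ sg i] is invisible modulo [p ^ sg i]; this makes the decoration of
    [t_i] respect its defining relation. *)
Lemma aff_label_alpha i x :
  aff_label (i, 0%R) (expgz aff_alpha (n i) * x) = aff_label (i, 0%R) x.
Proof.
congr (_, _); rewrite /= invgM aff_act_mul -expgzN aff_act_alpha.
apply: aff_act_cong; rewrite mulr0 add0r intrN nE mulrN -natrM.
have -> : (p ^ (N - sg i) * p ^ sg i = p ^ N)%N by rewrite -expnD subnK.
by rewrite natrX pN0 oppr0.
Qed.

Lemma aff_label_shift i z x :
  aff_label (i, 0%R) (expgz aff_alpha (- z)%R * x) = aff_label (i, z) x.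
Proof.
congr (_, _); rewrite /= invgM aff_act_mul -expgzN opprK aff_act_alpha.
by rewrite add0r.
Qed.

(** By [aff_conj_fix]; this is the invariance that [wreath_expgz2] asks for. *)
Lemma aff_label_fix y e x :
  aff_label y (expgz (aff_conj y) e * x) = aff_label y x.
Proof.
congr (_, _); rewrite invgM aff_act_mul -expgzN.
by rewrite (aff_fix_expgz _ (aff_conj_fix y)).
Qed.

(** Affine maps preserve congruences, so applying [x] to equal labels would make the two indices
    congruent modulo [n i]. *)
Lemma aff_label_adj u v x :
  gbs_adj n u v -> aff_label u.1 x != aff_label v.1 x.
Proof.
case: u v => [[i z] e] [[j w] e'] /=; apply: contraNneq.
move=> eq_uv; have ij : i = j := congr1 fst eq_uv.
rewrite -{j}ij eqxx /= in eq_uv *.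
pose k : R := (p ^ (N - sg i))%:R%R.
have eq_lab : (k * aff_act (x^-1%g : P) z%:~R =
               k * aff_act (x^-1%g : P) w%:~R)%R := congr1 snd eq_uv.
have := aff_act_cong x eq_lab; rewrite -!aff_act_mul !mulgV !aff_act1.
move/eqP; rewrite -subr_eq0 -mulrBr -intrB nE /k -[_%:R%R]/(_%:Z%:~R)%R.
rewrite -intrM intr_Zp_eq0 // abszM /dvdz /= -{1}(subnK (sgN i)) expnD.
by rewrite dvdn_pmul2l // expn_gt0 prime_gt0.
Qed.

Fixpoint aff_labels (L : seq (('I_r * int) * int)) : seq (('I_r * R) * int) :=
  if L is u :: L' then
    (aff_label u.1 (eval_syllables aff_conj L'), u.2) :: aff_labels L'
  else [::].

(** Adjacent labels are read at different points of [P], but [aff_label_fix] moves the second to the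
    point of the first, where [aff_label_adj] applies. *)
Lemma aff_labels_reduced L :
  gbs_reduced n L -> reduced_syllables (aff_labels L).
Proof.
case/andP=> srt nz; apply/andP; split; last first.
  by elim: L nz {srt} => //= u L IH /andP[-> /IH].
elim: L srt {nz} => // u [|v L] IH // /andP[uv /IH redL].
have adj : aff_label u.1 (eval_syllables aff_conj (v :: L)) !=
           aff_label v.1 (eval_syllables aff_conj L).
  rewrite -(aff_label_fix v.1 v.2 (eval_syllables aff_conj L)).
  exact: aff_label_adj.
by apply/andP; split.
Qed.

Section Morphism.
Variables (U : finGroupType) (h : 'I_r * R -> U).

Let W := wreath P U.

Definition gbs_to_wreath (x : option 'I_r) : W :=
  if x is Some i then (aff_tau i, [ffun x => h (aff_label (i, 0%R) x)])
  else (aff_alpha, [ffun=> 1]).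

Lemma gbs_to_wreath_alpha k :
  expgz (gbs_to_wreath None) k = (expgz aff_alpha k, [ffun=> 1]).
Proof.
rewrite [LHS]surjective_pairing wreath_expgz1; congr (_, _); apply/ffunP=> x.
rewrite wreath_expgz2 => [|y]; rewrite !ffunE //.
by case: k => j; rewrite /= expg1n ?invg1.
Qed.

(** Conjugation by a^z turns the decoration of [t_i] into that of the label [(i, z)], and powers are
    taken pointwise, so at 1 a product of syllables becomes the word of its labels. *)
Lemma gbs_wreath_morphism : exists f : {multiplicative gbs n m -> W},
  [/\ forall k, f (expgz (gbs_a n m) k) = (expgz aff_alpha k, [ffun=> 1]),
      forall L, (f (eval_syllables (gbs_conj n m) L)).1 =
        eval_syllables aff_conj L
    & forall L, (f (eval_syllables (gbs_conj n m) L)).2 1 =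
        eval_syllables h (aff_labels L)].
Proof.
have rel u v : gbs_rel n m u v ->
    eval_word gbs_to_wreath u = eval_word gbs_to_wreath v.
  case=> i [-> ->]; rewrite !eval_word_cat !eval_wpow [X in X * (_ * _)]mulg1.
  rewrite [X in _ * (_ * X)]mulg1 mulgA; apply: (canLR (mulgK _)).
  rewrite !gbs_to_wreath_alpha /=; congr (_, _).
    exact: aff_relation.
  apply/ffunP=> x; rewrite !ffunE mulg1 mul1g -/(aff_label _ _).
  by rewrite aff_label_alpha.
have [f [f1 fx]] := pres_lift rel; exists f.
have fa k : f (expgz (gbs_a n m) k) = (expgz aff_alpha k, [ffun=> 1]).
  by rewrite mult_morphXz fx gbs_to_wreath_alpha.
have fT1 y : (f (gbs_conj n m y)).1 = aff_conj y.
  rewrite /gbs_conj conjgE !gmulfM -expgzN !fa fx !wreath1E.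
  by rewrite /aff_conj conjgE -expgzN.
have fT2 y x : (f (gbs_conj n m y)).2 x = h (aff_label y x).
  rewrite /gbs_conj conjgE !gmulfM -expgzN !fa fx !wreath2E !ffunE /=.
  by rewrite mulg1 mul1g; case: y => i z; rewrite aff_label_shift.
have fTe2 y e x :
    (f (expgz (gbs_conj n m y) e)).2 x = expgz (h (aff_label y x)) e.
  rewrite mult_morphXz wreath_expgz2 ?fT2 // => x'.
  by rewrite !fT2 fT1 -[aff_conj y]expgz1 aff_label_fix.
have fL1 L :
    (f (eval_syllables (gbs_conj n m) L)).1 = eval_syllables aff_conj L.
  elim: L => [|u L IH] /=; first by rewrite mult_morph1.
  by rewrite gmulfM wreath1E IH mult_morphXz wreath_expgz1 fT1.
split=> //; elim=> [|u L IH] /=; first by rewrite mult_morph1 ffunE.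
by rewrite gmulfM wreath2E IH mulg1 fTe2 fL1.
Qed.
End Morphism.
End Quotient.

Lemma gbs_residually_p : residually_finite_p_group p (gbs n m).
Proof.
move=> g g1; have [k [L [redL gE]]] := gbs_normal_form mE cc1 g.
(* Large enough to bound every [sg i] and to have [|k| < p ^ N], so that a non-trivial a^k survives
   as a translation. *)
pose N := (\max_i sg i + `|k|).+1.
have N_gt0 : (0 < N)%N by [].
have sgN i : (sg i <= N)%N.
  by rewrite ltnW // ltnS (leq_trans (leq_bigmax i)) ?leq_addr.
pose P := affine (natrX_Zp_eq0 p_pr N_gt0).
have P_pgroup : p.-group [set: P] by apply/affine_pgroup/card_Zp_pnat.
have [L0|L_neq0] := eqVneq L [::].
  (* The translation part already detects a^k, so a constant decoration is enough. *)
  have [f [fa _ _]] := gbs_wreath_morphism N_gt0 sgN (fun=> 1 : P).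
  exists _, f; split; first exact: wreath_pgroup.
  rewrite gE L0 /= mulg1 fa => /(congr1 fst) /= ak.
  have := aff_act_alpha N_gt0 k 0%R; rewrite ak aff_act1 add0r.
  move=> /esym/eqP; rewrite intr_Zp_eq0 // => pNk.
  have k_gt0 : (0 < `|k|)%N.
    rewrite absz_gt0; apply/eqP=> k0; apply: g1.
    by rewrite gE L0 k0 expgz0 mulg1.
  have := dvdn_leq k_gt0 pNk; rewrite leqNgt => /negP[].
  apply: leq_ltn_trans (ltn_expl _ (prime_gt1 p_pr)).
  by rewrite ltnW // ltnS leq_addl.
have labs_red := aff_labels_reduced N_gt0 sgN redL.
have [|U [h [U_pgroup /eqP hL]]] := free_group_residually_p p_pr labs_red.
  by case: (L) L_neq0.
have [f [fa _ fL]] := gbs_wreath_morphism N_gt0 sgN h.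
exists _, f; split; first exact: wreath_pgroup.
rewrite gE => fg1; apply: hL; rewrite -fL.
have : (f (expgz (gbs_a n m) k * eval_syllables (gbs_conj n m) L)).2 1 = 1.
  by rewrite fg1 ffunE.
by rewrite gmulfM wreath2E fa ffunE mul1g.
Qed.

End Sufficiency.

Theorem mainTheorem2 (p : nat) (hp : prime p) (r : nat) (hr : (2 <= r)%N)
    (n m : 'I_r -> int)
    (hn0 : forall i, n i <> 0) (hm0 : forall i, m i <> 0)
    (hnm : forall i, 0 < n i <= `|m i|)
    (hnm1 : forall i, (n i, `|m i|) <> (1, 1)) :
  residually_finite_p_group p (gbs n m) <->
  (forall i, n i = m i /\ m i = (p ^ logn p `|m i|%N)%N%:Z) \/
  (p = 2%N /\
   forall i, n i = `|m i| /\ `|m i| = (2 ^ logn p `|m i|%N)%N%:Z).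
Proof.
split; first exact: rfp_exponents.
case=> [nm|[p2 nm]].
  apply: (@gbs_residually_p p r n m (fun=> 0) (fun i => logn p `|m i|) hp).
  - by move=> i; have [-> <-] := nm i.
  - by move=> i; rewrite mul0rn addr0 mul1r; case: (nm i).
  - by move=> i; rewrite mul0rn addr0 mul1r.
(* For [p = 2] the sign -1 is 1 + 2c with c = -1. *)
apply: (@gbs_residually_p p r n m (fun i => if m i < 0 then -1 else 0)
          (fun i => logn p `|m i|) hp).
- by move=> i; have [-> ->] := nm i; rewrite p2.
- by move=> i; have [-> _] := nm i; rewrite p2; case: ltrP; lia.
- by move=> i; rewrite p2; case: ifP.
Qed.
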